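(* Every quasi-Sturmian word $\mathbf{s}$ satisfies $\mathrm{rep}(\mathbf{s})\le\sqrt{10}-\frac32$.
   Context: For an infinite word $\mathbf{x}$ over a finite alphabet, $p(n,\mathbf{x})$ denotes the number of distinct factors of length $n$. A quasi-Sturmian word is an infinite word $\mathbf{x}$ over a finite alphabet for which there exist integers $k$ and $n_0$ with $p(n,\mathbf{x})=n+k$ for all $n\ge n_0$. With $x_i^j=x_i\cdots x_j$, let $r(n,\mathbf{x})=\min\{m\ge1:\ x_i^{i+n-1}=x_{m-n+1}^{m}\text{ for some } 1\le i\le m-n\}$, and $\mathrm{rep}(\mathbf{x})=\liminf_{n\to\infty} r(n,\mathbf{x})/n$. *)

(* Defs.v *)
From HB Require Import structures.
From mathcomp Require Import all_boot all_order all_algebra.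
From mathcomp Require Import all_classical all_reals all_analysis.
From mathcomp Require Import zify.
Set Implicit Arguments. Unset Strict Implicit. Unset Printing Implicit Defensive.
Import Order.TTheory GRing.Theory Num.Theory.

(* An infinite word over the finite alphabet A is x : nat -> A.
   Convention: the paper's letter x_i (i >= 1) is  x (i.-1), i.e. Rocq
   indices are 0-based.  *)

Definition factor (A : finType) (x : nat -> A) (i n : nat) : n.-tuple A :=
  [tuple x (i + k) | k < n].

Definition pcomp (A : finType) (x : nat -> A) (n : nat) : nat :=
  #|[set u : n.-tuple A | `[< exists i, u = factor x i n >]]|.

Definition quasi_sturmian (A : finType) (x : nat -> A) : Prop :=
  exists (k : int) (n0 : nat), forall n, (n0 <= n)%N ->
    ((pcomp x n)%:Z = n%:Z + k)%R.

(* The condition defining r(n,x), in the paper's 1-based indexing: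
   m >= 1 and there is i with 1 <= i <= m - n and
   x_i^{i+n-1} = x_{m-n+1}^m, i.e. x_{i+k} = x_{m-n+1+k} for k < n. *)
Definition rcond (A : finType) (x : nat -> A) (n m : nat) : Prop :=
  (1 <= m)%N /\ exists i, (1 <= i <= m - n)%N /\
    forall k, (k < n)%N -> x (i + k).-1 = x (m - n + 1 + k).-1.

Lemma rcond_exists (A : finType) (x : nat -> A) (n : nat) :
  exists m, rcond x n m.
Proof.
apply: contrapT => H.
pose f (i : 'I_(#|A| ^ n).+1) : n.-tuple A := factor x i n.
have finj : injective f.
  suff Hlt : forall i j : 'I_(#|A| ^ n).+1, (i < j)%N -> f i = f j -> False.
    move=> i j Hij; have [lt|gt|/val_inj //] := ltngtP i j; exfalso.
    - exact: (Hlt _ _ lt Hij).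
    - exact: (Hlt _ _ gt (esym Hij)).
  move=> i j Hij Hf; apply: H; exists (j + n).
  split; first by rewrite addn_gt0 (leq_ltn_trans _ Hij).
  exists i.+1; split.
    by rewrite /= addnK.
  move=> k Hk.
  have := congr1 (fun t : n.-tuple A => tnth t (Ordinal Hk)) Hf.
  rewrite /f /factor !tnth_mktuple /= addnK => ->.
  congr (x _); lia.
have := leq_card _ finj.
by rewrite card_tuple card_ord ltnn.
Qed.

Lemma rcond_existsb (A : finType) (x : nat -> A) (n : nat) :
  exists m, `[< rcond x n m >].
Proof. by have [m Hm] := rcond_exists x n; exists m; apply/asboolP. Qed.

Definition rfun (A : finType) (x : nat -> A) (n : nat) : nat :=
  ex_minn (rcond_existsb x n).

Definition rep (R : realType) (A : finType) (x : nat -> A) : \bar R :=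
  limn_einf (fun n => ((rfun x n)%:R / n%:R : R)%:E).

(* Main.v *)
Require Import Defs.
From HB Require Import structures.
From mathcomp Require Import all_boot all_order all_algebra.
From mathcomp Require Import all_classical all_reals all_analysis.
From mathcomp Require Import zify ring lra.
Import Order.TTheory GRing.Theory Num.Theory.
(* Again, since [factor] is shadowed by MathComp-Analysis. *)
Import Defs.
Set Implicit Arguments. Unset Strict Implicit. Unset Printing Implicit Defensive.

(** For large [n] a quasi-Sturmian word [x] has exactly one right special factor of
    length [n], and it has two right extensions. Cutting [x] at the occurrences of
    such a factor gives [x = W B_0 B_1 B_2 ...] with blocks of two kinds [U], [V], where
    the prefixes ending at the cuts have a common suffix of length [|U| + |V| + O(1)].
    By uniqueness of the right special factors, one kind of block is always followed
    by the other, so that the blocks can be regrouped into [U, VU] or [V, UV], as in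
    Rauzy induction.

    Assume [r(n,x) >= (1 + b) n] for all large [n], with [b > sqrt 10 - 5/2]. Put
    [f = |W|] and let [v], [u] be the lengths of [B_0] and of the other kind. The
    repetitions visible in [W B_0 B_1] force [B_1 <> B_0], [v >= b f] and
    [f >= b (u + v)] up to constants, and regrouping maps [(u, v, f)] to
    [(u, u + v, f)] or [(v, u + v, f + v)]. These inequalities exclude every infinite
    sequence of moves except those ending in the period
    [(u, v, f) -> (3u + 2v, 5u + 3v, f + 6u + 4v)], which corresponds to the partial
    quotients [2, 1, 1], and along it [v / f] tends to [sqrt 10 - 5/2 < b]. *)

(** * Right special factors *)

(** Dropping [t1] keeps the image, so by cardinality [f] is injective on the rest of [S] and every
    collision involves [t1]. *)
Lemma collision_unique (aT rT : finType) (f : aT -> rT) (S : {set aT})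
    (s1 s2 t1 t2 : aT) :
  #|S| = #|f @: S|.+1 -> s1 \in S -> s2 \in S -> t1 \in S -> t2 \in S ->
  s1 <> s2 -> f s1 = f s2 -> t1 <> t2 -> f t1 = f t2 -> t1 = s1 \/ t1 = s2.
Proof.
move=> cardS s1S s2S t1S t2S neq_s fs neq_t ft.
have imD : f @: (S :\ t1) = f @: S.
  apply/eqP; rewrite finset.eqEsubset imsetS ?finset.subD1set //=.
  apply/fintype.subsetP => _ /imsetP[z zS ->].
  have [->|nz] := eqVneq z t1; last by apply: imset_f; rewrite !inE nz.
  rewrite ft; apply: imset_f; rewrite !inE t2S andbT.
  by apply/eqP => E; apply: neq_t.
have injf : {in S :\ t1 &, injective f}.
  apply/imset_injP; rewrite imD.
  by have := cardsD1 t1 S; rewrite t1S cardS add1n => -[->].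
have [->|n1] := eqVneq t1 s1; first by left.
have [->|n2] := eqVneq t1 s2; first by right.
case: neq_s; apply: injf => //; rewrite !inE ?s1S ?s2S andbT eq_sym //.
Qed.

Section Words.
Variables (A : finType) (x : nat -> A).

(* The prefixes of length [p] and [q] end with the same [n] letters
   (meaningful only when [n <= p] and [n <= q]). *)
Definition same_end (p q n : nat) : Prop :=
  forall k, k < n -> x (p - 1 - k) = x (q - 1 - k).

(** As indices are 0-based, [x p] is the letter after the prefix of length [p]. *)
Definition unique_right_special (n : nat) : Prop :=
  forall p q p' q', n <= p -> n <= q -> n <= p' -> n <= q' ->
    same_end p q n -> x p <> x q -> same_end p' q' n -> x p' <> x q' ->
    same_end p p' n /\ (x p' = x p \/ x p' = x q).

Definition not_eventually_periodic : Prop :=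
  forall N p, 0 < p -> ~ (forall i, N <= i -> x (i + p) = x i).

Lemma same_end_sym p q n : same_end p q n -> same_end q p n.
Proof. by move=> H k kn; rewrite H. Qed.

Lemma same_end_trans p q t n : same_end p q n -> same_end q t n -> same_end p t n.
Proof. by move=> H H' k kn; rewrite H ?H'. Qed.

Lemma same_end_le p q m n : m <= n -> same_end p q n -> same_end p q m.
Proof. by move=> mn H k km; apply: H; lia. Qed.

Lemma same_endD p q m n : same_end p q n ->
  (forall k, k < m -> x (p + k) = x (q + k)) -> same_end (p + m) (q + m) (m + n).
Proof.
move=> H Hf k kmn; have [km|mk] := ltnP k m.
  have -> : p + m - 1 - k = p + (m - 1 - k) by lia.
  have -> : q + m - 1 - k = q + (m - 1 - k) by lia.
  by apply: Hf; lia.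
have -> : p + m - 1 - k = p - 1 - (k - m) by lia.
have -> : q + m - 1 - k = q - 1 - (k - m) by lia.
by apply: H; lia.
Qed.

Lemma same_endS p q n : same_end p q n -> x p = x q -> same_end p.+1 q.+1 n.+1.
Proof.
move=> H E; rewrite -[p.+1]addn1 -[q.+1]addn1 -add1n; apply: same_endD => // k.
by rewrite ltnS leqn0 => /eqP->; rewrite !addn0.
Qed.

Lemma same_end_factor p q n : n <= p -> n <= q ->
  same_end p q n <-> factor x (p - n) n = factor x (q - n) n.
Proof.
move=> np nq; split=> [H|H k kn].
  apply: eq_from_tnth => k; rewrite !tnth_mktuple.
  have kn := ltn_ord k.
  have -> : p - n + k = p - 1 - (n - 1 - k) by lia.
  have -> : q - n + k = q - 1 - (n - 1 - k) by lia.
  by apply: H; lia.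
have kn' : n - 1 - k < n by lia.
have := congr1 (fun t => tnth t (Ordinal kn')) H; rewrite !tnth_mktuple /=.
have -> : p - n + (n - 1 - k) = p - 1 - k by lia.
by have -> : q - n + (n - 1 - k) = q - 1 - k by lia.
Qed.

Lemma same_endS_factor p q n : n <= p -> n <= q ->
  factor x (p - n) n.+1 = factor x (q - n) n.+1 <-> same_end p q n /\ x p = x q.
Proof.
move=> np nq.
have -> : p - n = p.+1 - n.+1 by lia.
have -> : q - n = q.+1 - n.+1 by lia.
rewrite -same_end_factor //; split=> [H|[H E]].
  split=> [k kn|].
    have := H k.+1; rewrite ltnS => /(_ kn).
    have -> : p.+1 - 1 - k.+1 = p - 1 - k by lia.
    by have -> : q.+1 - 1 - k.+1 = q - 1 - k by lia.
  by have := H 0 isT; rewrite !subn0 !subn1.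
case=> [_|k kn]; first by rewrite !subn0 !subn1.
have -> : p.+1 - 1 - k.+1 = p - 1 - k by lia.
have -> : q.+1 - 1 - k.+1 = q - 1 - k by lia.
exact: H.
Qed.

(** Right special factors are the collisions of the map that drops the last letter of a factor of
    length [n.+1]. *)
Lemma pcomp_unique_right_special n :
  pcomp x n.+1 = (pcomp x n).+1 -> unique_right_special n.
Proof.
move=> Hp.
pose f (u : n.+1.-tuple A) : n.-tuple A :=
  [tuple tnth u (widen_ord (leqnSn n) k) | k < n].
have fE i : f (factor x i n.+1) = factor x i n.
  by apply: eq_from_tnth => k; rewrite !tnth_mktuple.
set S := [set u : n.+1.-tuple A | `[< exists i, u = factor x i n.+1 >]].
have SP i : factor x i n.+1 \in S by rewrite inE; apply/asboolP; exists i.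
have imS : f @: S = [set u : n.-tuple A | `[< exists i, u = factor x i n >]].
  apply/setP => u; rewrite inE; apply/imsetP/asboolP => [[w]|[i ->]].
    by rewrite inE => /asboolP[i ->] ->; exists i; rewrite fE.
  by exists (factor x i n.+1); rewrite ?fE.
have cS : #|S| = #|f @: S|.+1 by rewrite imS.
move=> p q p' q' np nq np' nq' Hpq npq Hpq' npq'.
have := collision_unique cS (SP (p - n)) (SP (q - n)) (SP (p' - n)) (SP (q' - n)).
rewrite !fE -!same_end_factor // => H.
have [||/same_endS_factor[] // E E'|/same_endS_factor[] // E E'] := H _ Hpq _ Hpq'.
- by move/same_endS_factor => [] //.
- by move/same_endS_factor => [] //.
- by split; [apply: same_end_sym|left].
- by split; [apply: same_end_trans Hpq (same_end_sym E)|right].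
Qed.

Lemma quasi_sturmian_unique_right_special : quasi_sturmian x ->
  exists n0, forall n, n0 <= n -> unique_right_special n.
Proof.
case=> k [n0 H]; exists n0 => n nn; apply: pcomp_unique_right_special.
by have := H n nn; have := H n.+1 (leqW nn); lia.
Qed.

Lemma pcomp_periodic_le N p n : 0 < p -> (forall i, N <= i -> x (i + p) = x i) ->
  pcomp x n <= N + p.
Proof.
move=> p0 per.
have red i : exists2 j, j < N + p & factor x i n = factor x j n.
  elim/ltn_ind: i => i IH; have [|le] := ltnP i (N + p); first by exists i.
  have [|j jlt E] := IH (i - p); first by lia.
  exists j => //; rewrite -E; apply: eq_from_tnth => k; rewrite !tnth_mktuple.
  have -> : i + k = i - p + k + p by lia.
  by apply: per; lia.
rewrite -[N + p]card_ord /pcomp.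
apply: leq_trans (leq_imset_card (fun i : 'I_(N + p) => factor x i n) predT).
apply: subset_leq_card; apply/fintype.subsetP => u; rewrite inE => /asboolP[i ->].
by have [j jlt ->] := red i; apply/imsetP; exists (Ordinal jlt).
Qed.

Lemma quasi_sturmian_not_eventually_periodic :
  quasi_sturmian x -> not_eventually_periodic.
Proof.
case=> k [n0 H] N p p0 per.
pose n := n0 + N + p + `|k|%N.+1.
have nn : n0 <= n by rewrite /n -!addnA leq_addr.
have := pcomp_periodic_le n p0 per; rewrite -lez_nat (H n nn) /n.
have := ler_norm (- k); rewrite normrN -abszE => hk.
rewrite !PoszD -addn1 PoszD => h.
have : (0 <= n0%:Z)%R by [].
by lia.
Qed.

(** Some factor of length [n] recurs beyond [M]; determinism then copies letter after letter, with
    period [q - p]. *)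
Lemma deterministic_periodic M n :
  (forall p q, M <= p -> M <= q -> n <= p -> n <= q -> same_end p q n -> x p = x q) ->
  ~ not_eventually_periodic.
Proof.
move=> det nep.
have [m [m1 [i [im E]]]] := rcond_exists (fun i => x (M + i)) n.
pose p := M + i.-1 + n; pose q := M + m.
have Hpq : same_end p q n.
  move=> k kn; have := E (n - 1 - k) ltac:(lia).
  have -> : M + (i + (n - 1 - k)).-1 = p - 1 - k by rewrite /p; lia.
  by have -> : M + (m - n + 1 + (n - 1 - k)).-1 = q - 1 - k by rewrite /q; lia.
have ext j : same_end (p + j) (q + j) n.
  elim: j => [|j IH]; first by rewrite !addn0.
  rewrite !addnS; apply: same_end_le (leqnSn n) _; apply: same_endS => //.
  by apply: det => //; rewrite /p /q; lia.
apply: (nep p (q - p)); first by rewrite /p /q; lia.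
move=> t pt.
have := det (p + (t - p)) (q + (t - p)) _ _ _ _ (ext _).
have -> : p + (t - p) = t by lia.
have -> : q + (t - p) = t + (q - p) by rewrite /p /q in pt *; lia.
by move=> ->//; rewrite /p /q in pt *; lia.
Qed.
End Words.

(** * Block decompositions *)

Section BlockDecomposition.
Variables (A : finType) (x : nat -> A) (a0 : A).

(* A block is identified by whether its first letter is [a0]. *)
Definition block_class (p : nat) : bool := x p == a0.

Definition next_cut (l : bool -> nat) (p : nat) : nat := p + l (block_class p).

Definition cut (l : bool -> nat) (f p : nat) : Prop :=
  exists i, p = iter i (next_cut l) f.

(* The suffix of [x] starting at [f] is cut into blocks of two kinds, with lengths
   [l true] and [l false], such that the prefixes of [x] ending at the cuts have,
   once the first [C0] letters are ignored, a common suffix of length [L], and [L]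
   cannot be increased. The constants [C0], [c1], [c2] are the same for all the
   decompositions derived from a given one. *)
Record decomposition (C0 c1 c2 : nat) (l : bool -> nat) (f L : nat) : Prop :=
  Decomposition {
    len_gt0 : forall c, 0 < l c;
    blockE : forall p q, cut l f p -> cut l f q -> block_class p = block_class q ->
      forall k, k < l (block_class p) -> x (p + k) = x (q + k);
    contextE : forall p q, cut l f p -> cut l f q ->
      forall k, k < L -> C0 + k < p -> C0 + k < q -> x (p - 1 - k) = x (q - 1 - k);
    context_lt : L + C0 < f + l (block_class f);
    context_neq : forall p q, cut l f p -> cut l f q ->
      block_class p != block_class q ->
      x (next_cut l p - 1 - L) <> x (next_cut l q - 1 - L);
    start_le : f <= L + C0;
    context_len : L + c1 = l true + l false + c2 }.

Lemma cut_start l f : cut l f f.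
Proof. by exists 0. Qed.

Lemma cut_next l f p : cut l f p -> cut l f (next_cut l p).
Proof. by case=> i ->; exists i.+1. Qed.

Lemma cut_ge l f p : cut l f p -> p = f \/ next_cut l f <= p.
Proof.
case=> -[|i] ->; [by left|right].
elim: i => [|i IH] //=; apply: leq_trans IH _.
by rewrite [X in _ <= X]/next_cut leq_addr.
Qed.

(** * One step of Rauzy induction on a decomposition *)

Section Derivation.
Variables (C0 c1 c2 : nat) (l : bool -> nat) (f L : nat).
Hypothesis dec : decomposition C0 c1 c2 l f L.

Lemma context_room p : cut l f p -> L + C0 < next_cut l p.
Proof.
move=> op; have h := context_lt dec; rewrite /next_cut.
by case: (cut_ge op) => [->//|]; rewrite /next_cut; lia.
Qed.

Lemma same_end_next p q : cut l f p -> cut l f q ->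
  block_class p = block_class q -> same_end x (next_cut l p) (next_cut l q) L.+1.
Proof.
move=> op oq cpq k kL; have rp := context_room op; have rq := context_room oq.
move: rp rq; rewrite /next_cut -cpq; set m := l _ => rp rq.
have [km|mk] := ltnP k m.
  have -> : p + m - 1 - k = p + (m - 1 - k) by lia.
  have -> : q + m - 1 - k = q + (m - 1 - k) by lia.
  by apply: (blockE dec) => //; rewrite -/m; lia.
have -> : p + m - 1 - k = p - 1 - (k - m) by lia.
have -> : q + m - 1 - k = q - 1 - (k - m) by lia.
have m0 : 0 < m := len_gt0 dec _.
by apply: (contextE dec) => //; lia.
Qed.

Lemma next_cut_same_periodic p : cut l f p ->
  block_class (next_cut l p) = block_class p ->
  forall k, k < l (block_class p) -> x (p + k + l (block_class p)) = x (p + k).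
Proof.
move=> op E k kl.
have := blockE dec op (cut_next op) (esym E) kl.
by rewrite /next_cut => ->; congr x; lia.
Qed.

Hypothesis nep : not_eventually_periodic x.

(** Otherwise only blocks of class [c] follow, and [x] has eventual period [l c]. *)
Lemma class_change c : (exists2 p, cut l f p & block_class p = c) ->
  exists p, [/\ cut l f p, block_class p = c & block_class (next_cut l p) = ~~ c].
Proof.
case=> p op cp; apply: contrapT => H.
have const i : let q := iter i (next_cut l) p in
    [/\ cut l f q, block_class q = c & q = p + i * l c].
  elim: i => [|i [oq cq eq]] /=; first by rewrite addn0.
  have cq' : block_class (next_cut l (iter i (next_cut l) p)) = c.
    apply: contrapT => /eqP; case: eqP => // nc _; apply: H.
    exists (iter i (next_cut l) p); split => //.
    by move: nc; case: (block_class _); case: (c).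
  by split => //; [exact: cut_next|rewrite /next_cut cq eq; lia].
have l0 : 0 < l c := len_gt0 dec c.
apply: (nep (N := p) l0) => i pi.
have [oq cq eq] := const ((i - p) %/ l c).
have [_ cq1 _] := const ((i - p) %/ l c).+1.
have := @next_cut_same_periodic _ oq; rewrite cq => /(_ cq1) /(_ ((i - p) %% l c)).
rewrite ltn_mod eq => /(_ l0).
have := divn_eq (i - p) (l c) => E.
by have -> : p + (i - p) %/ l c * l c + (i - p) %% l c = i by lia.
Qed.

(** If each class were somewhere followed by itself, [class_change] would make the suffix of length
    [L.+1] after either class right special; uniqueness would identify the two suffixes, against
    [context_neq]. *)
Lemma dominant_class : unique_right_special x L.+1 ->
  exists c, forall p, cut l f p -> block_class p = ~~ c ->
    block_class (next_cut l p) = c.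
Proof.
move=> urs; apply: contrapT => H.
have dbl c : exists p, [/\ cut l f p, block_class p = c
    & block_class (next_cut l p) = c].
  apply: contrapT => H'; apply: H; exists (~~ c) => p op.
  rewrite negbK => cp; apply: contrapT => nc; apply: H'; exists p; split => //.
  by move: nc; case: (block_class _); case: (c).
have spec c : exists p q, [/\ cut l f p, cut l f q, block_class p = c,
    block_class q = c & x (next_cut l p) <> x (next_cut l q)].
  have [p [op cp cp']] := dbl c.
  have [|q [oq cq cq']] := @class_change c; first by exists p.
  exists p, q; split => // E; move: cp' cq'; rewrite /block_class E => -> /eqP.
  by case: (c).
have [p [q [op oq cp cq n1]]] := spec true.
have [p' [q' [op' oq' cp' cq' n2]]] := spec false.
have room z : cut l f z -> L.+1 <= next_cut l z.
  by move=> oz; have := context_room oz; lia.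
have [E _] := urs _ _ _ _ (room _ op) (room _ oq) (room _ op') (room _ oq')
  (same_end_next op oq (etrans cp (esym cq))) n1
  (same_end_next op' oq' (etrans cp' (esym cq'))) n2.
by apply: (context_neq dec op op'); rewrite ?cp ?cp' //; apply: E.
Qed.

Variable c : bool.
Hypothesis dom : forall p, cut l f p -> block_class p = ~~ c ->
  block_class (next_cut l p) = c.

(** A block of class [~~ c] absorbs the block of class [c] after it. *)
Definition derived_len (b : bool) : nat := if b == c then l c else l c + l (~~ c).

(** A leading block of class [c] joins the prefix. Thus every cut, except possibly an unchanged
    start, follows a block of class [c], which lengthens the common suffix by [l c]. *)
Definition derived_start : nat := if block_class f == c then f + l c else f.

Lemma derived_cut p : cut derived_len derived_start p ->
  cut l f p /\ ((p = f /\ block_class f = ~~ c) \/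
    exists q, [/\ cut l f q, block_class q = c & p = q + l c]).
Proof.
case=> i ->{p}; elim: i => [|i [IH _]] /=.
  rewrite /derived_start; case: eqP => E.
    have of1 : cut l f (f + l c) by rewrite -E; exact: cut_next (cut_start _ _).
    by split => //; right; exists f; split => //; exact: cut_start.
  split; first exact: cut_start.
  by left; split => //; move: E; case: (block_class _); case: (c).
set p := iter _ _ _ in IH *; rewrite {1 3}/next_cut /derived_len.
case: eqP => E.
  by split; [rewrite -E; exact: cut_next|right; exists p].
have cp : block_class p = ~~ c by move: E; case: (block_class _); case: (c).
have -> : p + (l c + l (~~ c)) = next_cut l p + l c by rewrite /next_cut cp; lia.
have cn := dom IH cp; split.
  by rewrite -{1}cn; apply: cut_next; apply: cut_next.
by right; exists (next_cut l p); split => //; exact: cut_next.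
Qed.

Lemma derived_decomposition :
  decomposition C0 c1 c2 derived_len derived_start (L + l c).
Proof.
have cE b : b != c -> b = ~~ c by case: b; case: (c).
have lc0 := len_gt0 dec c; have lc0' := len_gt0 dec (~~ c).
have clt := context_lt dec; have sle := start_le dec.
split.
- by move=> b; rewrite /derived_len; case: eqP => _; lia.
- move=> p q /derived_cut[op _] /derived_cut[oq _] cpq k; rewrite /derived_len.
  case: eqP => [E kl|/eqP/cE E kl]; first by apply: (blockE dec) => //; rewrite E.
  have cp := dom op E; have cq := dom oq (etrans (esym cpq) E).
  have [kl1|kl1] := ltnP k (l (~~ c)); first by apply: (blockE dec) => //; rewrite E.
  have := blockE dec (cut_next op) (cut_next oq) (etrans cp (esym cq)).
  rewrite cp /next_cut -cpq E => /(_ (k - l (~~ c)) ltac:(lia)).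
  have -> : p + l (~~ c) + (k - l (~~ c)) = p + k by lia.
  by have -> : q + l (~~ c) + (k - l (~~ c)) = q + k by lia.
- move=> p q /derived_cut[op Hp] /derived_cut[oq Hq] k kL kp kq.
  have [kL'|Lk] := ltnP k L; first exact: (contextE dec).
  (* By [start_le], an unchanged start has nothing to compare at depth [k >= L]. *)
  case: Hp => [[pf _]|[p' [op' cp' pE]]]; first by lia.
  case: Hq => [[qf _]|[q' [oq' cq' qE]]]; first by lia.
  rewrite {}pE {}qE in kp kq *.
  have [kl|lk] := ltnP k (l c).
    have -> : p' + l c - 1 - k = p' + (l c - 1 - k) by lia.
    have -> : q' + l c - 1 - k = q' + (l c - 1 - k) by lia.
    by apply: (blockE dec) => //; rewrite ?cp' ?cq' //; lia.
  have -> : p' + l c - 1 - k = p' - 1 - (k - l c) by lia.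
  have -> : q' + l c - 1 - k = q' - 1 - (k - l c) by lia.
  by apply: (contextE dec) => //; lia.
- rewrite /derived_start; case: eqP => [E|/eqP/cE E].
    rewrite E in clt; rewrite /derived_len; case: eqP => _; lia.
  by move: clt; rewrite /derived_len E; case: (c) => /=; lia.
(* The old mismatch, between the ends of the block before [p] and of the block at [q], is seen [l c]
   letters deeper. *)
- have key p q : cut derived_len derived_start p -> cut derived_len derived_start q ->
      block_class p = c -> block_class q = ~~ c ->
      x (next_cut derived_len p - 1 - (L + l c)) <>
      x (next_cut derived_len q - 1 - (L + l c)).
    move=> /derived_cut[op Hp] /derived_cut[oq _] cp cq.
    case: Hp => [[pf cf]|[p' [op' cp' pE]]].
      by move: cp; rewrite pf cf; case: (c).
    have := context_neq dec op' oq; rewrite cp' cq => /(_ ltac:(by case: (c))).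
    rewrite /next_cut /derived_len cp' cp cq eqxx.
    have -> : (~~ c == c) = false by case: (c).
    have -> : p' + l c - 1 - L = p + l c - 1 - (L + l c) by lia.
    by have -> : q + l (~~ c) - 1 - L = q + (l c + l (~~ c)) - 1 - (L + l c) by lia.
  move=> p q op oq npq; have [cp|/cE cp] := eqVneq (block_class p) c.
    by apply: key => //; apply: cE; rewrite eq_sym -cp.
  have [cq|/cE cq] := eqVneq (block_class q) c; last by rewrite cp cq eqxx in npq.
  by move=> E; apply: (key q p).
- by rewrite /derived_start; case: eqP => _; lia.
- by have := context_len dec; rewrite /derived_len; case: (c) => /=; lia.
Qed.

End Derivation.
End BlockDecomposition.

(** * Return words of a right special factor *)

Section InitialDecomposition.
Variables (A : finType) (x : nat -> A).

Lemma exists_right_special n M : not_eventually_periodic x ->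
  exists p q, [/\ M <= p, n <= p, n <= q, same_end x p q n & x p <> x q].
Proof.
move=> nep; apply: contrapT => H.
apply: (deterministic_periodic (x := x) (M := M) (n := n)) nep => p q Mp Mq np nq E.
by apply: contrapT => neq; apply: H; exists p, q.
Qed.

Section ReturnWords.
Variables (n p0 p1 : nat).
Hypothesis urs : unique_right_special x n.
Hypotheses (np0 : n <= p0) (np1 : n <= p1).
Hypotheses (E01 : same_end x p0 p1 n) (x01 : x p0 <> x p1).
Hypothesis nep : not_eventually_periodic x.

Let occ p := n <= p /\ same_end x p0 p n.
Let cls := block_class x (x p0).
Let rp (c : bool) := if c then p0 else p1.

Lemma occ_rp c : occ (rp c).
Proof. by case: c; split. Qed.

Lemma cls_rp c : cls (rp c) = c.
Proof. by case: c; rewrite /cls /block_class /= ?eqxx //; apply/eqP/nesym. Qed.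

Lemma occ_same_end p q : occ p -> occ q -> same_end x p q n.
Proof. by move=> [_ E] [_ E']; apply: same_end_trans (same_end_sym E) E'. Qed.

Lemma occ_right_special p q : n <= p -> n <= q -> same_end x p q n -> x p <> x q ->
  occ p.
Proof. by move=> np nq E neq; split => //; have [] := urs np0 np1 np nq E01 x01 E neq. Qed.

Lemma occ_letter p q : occ p -> occ q -> cls p = cls q -> x p = x q.
Proof.
have other z : occ z -> x z != x p0 -> x z = x p1.
  move=> [nz Ez] /eqP neq.
  by have [_ []] := urs np0 np1 nz np0 E01 x01 (same_end_sym Ez) neq.
rewrite /cls /block_class => op oq.
case: eqP => [-> /esym/eqP->//|/eqP np /esym/negbT nq].
by rewrite (other p op np) (other q oq nq).
Qed.

Lemma exists_return p : occ p ->
  exists d, [/\ 0 < d, occ (p + d) & forall e, 0 < e < d -> ~ occ (p + e)].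
Proof.
move=> op; have ex : exists d, `[< 0 < d /\ occ (p + d) >].
  have [q [t [pq nq nt E neq]]] := exists_right_special n p.+1 nep.
  exists (q - p); apply/asboolP; split; first by lia.
  have -> : p + (q - p) = q by lia.
  exact: occ_right_special nq nt E neq.
case: (ex_minnP ex) => d /asboolP[d0 od] dmin; exists d; split => // e /andP[e0 ed] oe.
by have := dmin e (asboolT (conj e0 oe)); lia.
Qed.

(** A first disagreement would exhibit a right special factor, hence an occurrence before
    [p + d]. *)
Lemma occ_determines p q d : occ p -> occ q -> cls p = cls q ->
  (forall e, 0 < e < d -> ~ occ (p + e)) -> forall j, j < d -> x (p + j) = x (q + j).
Proof.
move=> op oq cpq nocc; elim/ltn_ind => -[|j] IH jd.
  by rewrite !addn0; apply: occ_letter.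
apply: contrapT => neq; apply: (nocc j.+1) => //.
have [[np _] [nq _]] := (op, oq).
apply: (occ_right_special _ _ _ neq); [lia|lia|].
apply: (@same_end_le _ _ _ _ _ (j.+1 + n)); first by lia.
by apply: same_endD; [exact: occ_same_end|move=> k kj; apply: IH => //; lia].
Qed.

Lemma occ_shift p q d e : occ p -> occ q -> cls p = cls q ->
  (forall e, 0 < e < d -> ~ occ (p + e)) -> e <= d -> occ (p + e) <-> occ (q + e).
Proof.
move=> op oq cpq nocc ed; have [[np _] [nq _]] := (op, oq).
have E : same_end x (p + e) (q + e) n.
  apply: (@same_end_le _ _ _ _ _ (e + n)); first by lia.
  apply: same_endD => [|k ke]; first exact: occ_same_end.
  by apply: (occ_determines op oq cpq nocc); lia.
split=> -[_ E']; (split; first by lia).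
  exact: same_end_trans E' E.
exact: same_end_trans E' (same_end_sym E).
Qed.

Lemma exists_return_lengths : exists l : bool -> nat, (forall c, 0 < l c) /\
  forall p, occ p -> occ (next_cut x (x p0) l p) /\
    forall e, 0 < e < l (cls p) -> ~ occ (p + e).
Proof.
have [d0 [d0_gt0 o0 n0]] := exists_return (occ_rp true).
have [d1 [d1_gt0 o1 n1]] := exists_return (occ_rp false).
pose l c := if c then d0 else d1.
have lP c : occ (rp c + l c) /\ forall e, 0 < e < l c -> ~ occ (rp c + e).
  by case: c.
exists l; split=> [|p op]; first by case.
have [oc nc] := lP (cls p).
have cE : cls (rp (cls p)) = cls p by rewrite cls_rp.
split=> [|e el].
  by rewrite /next_cut -/cls; apply/(occ_shift (occ_rp _) op cE nc (leqnn _)).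
move/(occ_shift (occ_rp _) op cE nc); case/andP: (el) => _ /ltnW eL /(_ eL).
exact: nc.
Qed.

(** Every cut ends a return, and so looks like the end of the return from [p0] or from [p1]; [L] is
    the first depth where these two differ. *)
Lemma initial_decomposition :
  exists C0 c1 c2 l f L, decomposition x (x p0) C0 c1 c2 l f L /\ n <= L.
Proof.
have [l [l0 lP]] := exists_return_lengths.
pose nx := next_cut x (x p0) l.
have blk p q : occ p -> occ q -> cls p = cls q ->
    forall k, k < l (cls p) -> x (p + k) = x (q + k).
  by move=> op oq cpq; apply: occ_determines => //; have [] := lP p op.
have endE p : occ p -> same_end x (nx (rp (cls p))) (nx p) (l (cls p) + n).
  move=> op; rewrite /nx /next_cut -/cls cls_rp.
  apply: same_endD; first by apply: occ_same_end => //; exact: occ_rp.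
  move=> k kl; apply: blk => //; rewrite ?cls_rp //; exact: occ_rp.
(* Without such a mismatch, the occurrence before the shorter block would reappear inside the longer
   return. *)
have shorter c : l c < l (~~ c) ->
    exists2 k, k < n + minn (l true) (l false) & x (nx p0 - 1 - k) <> x (nx p1 - 1 - k).
  move=> lc; apply: contrapT => H.
  have [_ nocc] := lP _ (occ_rp (~~ c)).
  apply: (nocc (l (~~ c) - l c)); first by rewrite cls_rp; have := l0 c; lia.
  have [nr _] := occ_rp (~~ c); have [nr' Er'] := occ_rp c.
  split; first by lia.
  apply: same_end_trans Er' _ => k kn.
  have -> : rp c - 1 - k = nx (rp c) - 1 - (l c + k).
    by rewrite /nx /next_cut -/cls cls_rp; lia.
  have -> : rp (~~ c) + (l (~~ c) - l c) - 1 - k = nx (rp (~~ c)) - 1 - (l c + k).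
    by rewrite /nx /next_cut -/cls cls_rp; lia.
  apply: contrapT => neq; apply: H; exists (l c + k).
    by move: lc; case: (c) => /=; lia.
  by move: neq; case: (c) => //= neq E; apply: neq.
have [k1 k1_lt k1_neq] : exists2 k, k < n + minn (l true) (l false) &
    x (nx p0 - 1 - k) <> x (nx p1 - 1 - k).
  have [lt|lt|E] := ltngtP (l true) (l false).
  - by have [k kl neq] := shorter true lt; exists k => //; lia.
  - by have [k kl neq] := shorter false lt; exists k => //; lia.
  exists (l true - 1); first by have := l0 false; lia.
  have -> : nx p0 - 1 - (l true - 1) = p0.
    by rewrite /nx /next_cut -/cls (cls_rp true); have := l0 true; lia.
  have -> // : nx p1 - 1 - (l true - 1) = p1.
  by rewrite /nx /next_cut -/cls (cls_rp false); have := l0 false; lia.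
have ex : exists k, `[< x (nx p0 - 1 - k) <> x (nx p1 - 1 - k) >].
  by exists k1; apply/asboolP.
case: (ex_minnP ex) => L /asboolP L_neq L_min {ex}.
have L_lt c : L < l c + n.
  by have := L_min k1 (asboolT k1_neq); case: c; lia.
have below k : k < L -> x (nx p0 - 1 - k) = x (nx p1 - 1 - k).
  by move=> kL; apply: contrapT => neq; have := L_min k (asboolT neq); lia.
have nL : n <= L.
  rewrite leqNgt; apply/negP => Ln; apply: L_neq.
  have [oc0 _] := lP _ (occ_rp true); have [oc1 _] := lP _ (occ_rp false).
  exact: (occ_same_end oc0 oc1).
pose f := nx p0.
have cutP p : cut x (x p0) l f p -> occ p /\ exists2 q, occ q & p = nx q.
  case=> i ->{p}; elim: i => [|i [IH _]] /=.
    by have [oc0 _] := lP _ (occ_rp true); split => //; exists p0 => //; exact: (occ_rp true).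
  by have [oc1 _] := lP _ IH; split => //; eexists; first exact: IH.
have fL : L + (f - L) = f.
  by have := L_lt true; rewrite /f /nx /next_cut -/cls (cls_rp true) /=; lia.
(* These constants turn [start_le] into an equality and make [context_len] trivial. *)
exists (f - L), (l true + l false), L, l, f, L; split => //; split => //.
- by move=> p q /cutP[op _] /cutP[oq _]; apply: blk.
- move=> p q /cutP[_ [p' op' ->]] /cutP[_ [q' oq' ->]] k kL _ _.
  have lt c : k < l c + n by apply: ltn_trans kL (L_lt c).
  rewrite -(endE p' op') // -(endE q' oq') //.
  by case: (cls p'); case: (cls q') => //=; rewrite below.
- by rewrite fL -[X in X < _]addn0 ltn_add2l.
- move=> p q /cutP[op _] /cutP[oq _] npq; rewrite -/nx.
  rewrite -(endE p op) // -(endE q oq) //.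
  by move: npq; rewrite -/cls; case: (cls p); case: (cls q) => //= _ E; apply: L_neq.
- by rewrite fL.
- by rewrite addnC.
Qed.
End ReturnWords.

Lemma exists_decomposition n : unique_right_special x n -> not_eventually_periodic x ->
  exists a0 C0 c1 c2 l f L, decomposition x a0 C0 c1 c2 l f L /\ n <= L.
Proof.
move=> urs nep; have [p [q [_ np nq E neq]]] := exists_right_special n 0 nep.
by exists (x p); exact: (initial_decomposition urs np nq E neq nep).
Qed.
End InitialDecomposition.

(** * Renormalization of the block lengths *)

(* [G u v f] stands for: after a prefix of length [f], the word starts with a block of
   length [v] followed by a block of length [u]. [Gfirst] and [Gsecond] say that
   [v / f] and [f / (u + v)] are at least [0.662 < sqrt 10 - 5/2], up to a constant. *)
Section Renormalization.
Variables (G : nat -> nat -> nat -> Prop) (C V0 : nat).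
Hypothesis V0C : 1000 * C + 1000 <= V0.
Hypothesis Gu : forall u v f, G u v f -> 0 < u.
Hypothesis Gsum : forall u v f, G u v f -> V0 <= u + v.
Hypothesis Gf : forall u v f, G u v f -> f <= u + v + C.
Hypothesis Gfirst : forall u v f, G u v f -> 662 * f <= 1000 * v + C.
Hypothesis Gsecond : forall u v f, G u v f -> 662 * (u + v) <= 1000 * f + C.
Hypothesis Gnext : forall u v f, G u v f -> G u (u + v) f \/ G v (u + v) (f + v).

(** With [t = v / u], [marked] means [1 <= t <= 2] and [strong] means [4/3 <= t <= 7/4]. [strongB]
    records the result of the moves [(u, u + v, f)], [(u + v, 2u + v, f + u + v)] and [Gsecond] in
    between. *)
Let marked u v f := [/\ G u v f, u <= v & v <= 2 * u].
Let strong u v f := [/\ G u v f, 4 * v <= 7 * u & 4 * u <= 3 * v].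
Let strongB u v f := [/\ strong u v f, strong (u + v) (2 * u + v) (f + u + v)
  & 662 * (2 * u + v) <= 1000 * f + C].

(** By [Gsecond], moves that keep [f] cannot go on forever; once [u <= v], a move of the other kind
    yields a marked triple. *)
Lemma exists_marked u v f : G u v f -> exists u' v' f', marked u' v' f'.
Proof.
move=> g.
have [u1 [v1 [f1 [g1 uv1]]]] : exists u' v' f', G u' v' f' /\ u' <= v'.
  case: (Gnext g) => g'; first by exists u, (u + v), f; split => //; lia.
  by exists v, (u + v), (f + v); split => //; lia.
have : forall j, (exists u' v' f', marked u' v' f') \/ G u1 (v1 + j * u1) f1.
  elim=> [|j [|IH]]; first by right; rewrite addn0.
    by left.
  case: (Gnext IH) => g'; first by right; move: g'; congr (G _ _ _); lia.
  by left; do 3 eexists; split; first exact: g'; lia.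
case/(_ (1000 * f1 + C + 1)) => // g'.
have := Gsecond g'; have := Gu g1; nia.
Qed.

(** Two successive moves keeping [f] would give [662 (3u + v) <= 1000 f + C], which [Gf] and
    [v <= 2u] exclude. *)
Lemma marked_next u v f : marked u v f ->
  marked v (u + v) (f + v) \/
  (marked (u + v) (2 * u + v) (f + u + v) /\ 662 * (2 * u + v) <= 1000 * f + C).
Proof.
case=> g uv vu; have g0 := Gsum g; have gf := Gf g.
case: (Gnext g) => [g1|g1]; last by left; split => //; lia.
right; have s1 := Gsecond g1; split; last by lia.
case: (Gnext g1) => [g2|g2]; first by have := Gsecond g2; lia.
split; [|lia|lia].
by move: g2; congr (G _ _ _); lia.
Qed.

(** The interval from 4/3 to 7/4 is stable under [t -> 1 + 1/t] and [t -> 1 + 1/(1 + t)], the two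
    effects on [v / u]. *)
Lemma strong_next u v f : strong u v f ->
  strong v (u + v) (f + v) \/ strongB u v f.
Proof.
move=> st; have [g uv vu] := st.
have mk : marked u v f by split => //; lia.
case: (marked_next mk) => [[g1 _ _]|[[g1 _ _] h]]; first by left; split => //; lia.
by right; split => //; split => //; lia.
Qed.

Lemma exists_strong u v f : G u v f -> exists u' v' f', strong u' v' f'.
Proof.
case/exists_marked => u1 [v1 [f1 mk]]; have [g uv vu] := mk.
case: (marked_next mk) => [mk1|[[g1 _ _] h]]; last first.
  by do 3 eexists; split; first exact: g1; lia.
have [g1 uv1 vu1] := mk1.
case: (marked_next mk1) => [[g2 _ _]|[[g2 _ _] h]];
  by do 3 eexists; split; first exact: g2; lia.
Qed.

(* Along the moves [(v, u + v, f + v)] the quantity [u + v - f] does not change,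
   while [Gfirst] bounds it below by a positive multiple of [v]. *)
Lemma exists_strongB u v f : G u v f -> exists u' v' f', strongB u' v' f'.
Proof.
case/exists_strong => u1 [v1 [f1 st]].
have : forall j, (exists u' v' f', strongB u' v' f') \/
    exists u' v' f', [/\ strong u' v' f', j <= v' & u' + v' + f1 = f' + u1 + v1].
  elim=> [|j [|[u2 [v2 [f2 [st2 jv e]]]]]]; first by right; exists u1, v1, f1; split => //; lia.
    by left.
  case: (strong_next st2) => st3; last by left; exists u2, v2, f2.
  right; exists v2, (u2 + v2), (f2 + v2); split => //; last by lia.
  by have [g _ _] := st2; have := Gu g; lia.
case/(_ (1000 * (u1 + v1 + C) + 1)) => // -[u2 [v2 [f2 [[g2 h1 h2] jv e]]]].
have := Gfirst g2; lia.
Qed.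

(* After a move of [strongB], the inequalities leave exactly one continuation: two
   moves [(v, u + v, f + v)], then [strongB] again. *)
Lemma strongB_next u v f : strongB u v f ->
  strongB (3 * u + 2 * v) (5 * u + 3 * v) (f + 6 * u + 4 * v).
Proof.
case=> -[g h1 h2] st1 hB; have g0 := Gsum g; have gf := Gf g.
have [g1 _ _] := st1; have i1 := Gfirst g1.
case: (strong_next st1) => [st2|[_ _ h]]; last by lia.
have [g2 _ _] := st2; have i2 := Gfirst g2.
case: (strong_next st2) => [st3|[_ _ h]]; last by lia.
case: (strong_next st3) => [[g4 _ _]|]; first by have := Gfirst g4; lia.
by congr (strongB _ _ _); lia.
Qed.

Local Open Scope ring_scope.

(* The composite move of [strongB_next] preserves [3 f - 4 u - 2 v] and multiplies
   [r u - 2 v] by [3 - r]; both thus stay bounded while [u] and [v] grow, which makes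
   [v / f] tend to [r - 5/2]. *)
Lemma renormalization_absurd (R : archiRealFieldType) (r b : R) u v f :
  0 <= r -> r ^+ 2 = 10 -> r - 5 / 2 < b ->
  (forall u v f, G u v f -> b * f%:R <= v%:R + C%:R) -> ~ G u v f.
Proof.
move=> r0 r2 rb Gb /exists_strongB[u1 [v1 [f1 stB]]].
(* Both [3 - r] and [4 - r] then have absolute value at most 1. *)
have r3 : 3 < r by nra.
have r4 : r < 4 by nra.
pose D : R := `|r * u1%:R - 2 * v1%:R|.
pose E : R := 3 * f1%:R - 4 * u1%:R - 2 * v1%:R.
have iterT : forall j : nat, exists u v f, [/\ strongB u v f, (j <= v)%N,
    `|r * u%:R - 2 * v%:R| <= D & 3 * f%:R - 4 * u%:R - 2 * v%:R = E].
  elim=> [|j [u2 [v2 [f2 [st2 jv d2 e2]]]]]; first by exists u1, v1, f1.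
  do 3 eexists; split; first exact: (strongB_next st2).
  - by have [[g _ _] _ _] := st2; have := Gu g; lia.
  - rewrite (natrD R (3 * u2)) (natrD R (5 * u2)) !natrM.
    have -> : r * (3%:R * u2%:R + 2%:R * v2%:R) - 2 * (5%:R * u2%:R + 3%:R * v2%:R)
       = (3 - r) * (r * u2%:R - 2 * v2%:R) + (r ^+ 2 - 10) * u2%:R by ring.
    rewrite r2 subrr mul0r addr0.
    apply: le_trans d2; rewrite normrM ler_piMl //.
    by rewrite ler_norml; lra.
  - rewrite -e2 (natrD R (3 * u2)) (natrD R (5 * u2)) (natrD R (f2 + 6 * u2)).
    by rewrite (natrD R f2) !natrM; ring.
pose e := b - (r - 5 / 2).
have e0 : 0 < e by rewrite subr_gt0.
pose K := (D + 3 * `|b * E| + 3 * C%:R) / e.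
have K0 : 0 <= K.
  apply: divr_ge0; last exact: ltW.
  have : 0 <= D := normr_ge0 _.
  by have := normr_ge0 (b * E); have := ler0n R C; lra.
have [u2 [v2 [f2 [[[g2 _ _] _ _] jv d2 e2]]]] := iterT (Num.trunc K).+1.
have Kv : K < v2%:R.
  by apply: lt_le_trans (truncnS_gt K) _; rewrite ler_nat.
have {Kv} : D + 3 * `|b * E| + 3 * C%:R < e * v2%:R.
  by move: Kv; rewrite ltr_pdivrMr // [e * _]mulrC.
have := Gb _ _ _ g2.
have fE : 3 * f2%:R = 4 * u2%:R + 2 * v2%:R + E :> R by rewrite -e2; ring.
rewrite -(ler_pM2l (ltr0n R 3)) mulrCA fE => h.
have := ler_norm (- (b * E)); rewrite normrN => hE.
(* As [3 f = 4 u + 2 v + E], this bounds [v - (r - 5/2) f], whereas [b] exceeds [r - 5/2] by [e]. *)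
have idv : 3 * v2%:R - (r - 5 / 2) * (4 * u2%:R + 2 * v2%:R)
  = - (4 - r) * (r * u2%:R - 2 * v2%:R) + (10 - r ^+ 2) * u2%:R by field.
rewrite r2 subrr mul0r addr0 in idv.
have hd : - (4 - r) * (r * u2%:R - 2 * v2%:R) <= D.
  apply: le_trans d2; apply: le_trans (ler_norm _) _.
  by rewrite normrM ler_piMl // normrN ler_norml; lra.
have hu : 0 <= e * u2%:R by rewrite mulr_ge0 // ltW.
have hv : 0 <= e * v2%:R by rewrite mulr_ge0 // ltW.
move=> hK.
have : b * (4 * u2%:R + 2 * v2%:R + E) =
  4 * (e * u2%:R) + 2 * (e * v2%:R) + (r - 5 / 2) * (4 * u2%:R + 2 * v2%:R) + b * E.
  by rewrite /e; ring.
have nE : 0 <= `|b * E| := normr_ge0 _.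
lra.
Qed.
End Renormalization.

(** * Words without early repetitions *)

Section LateRepetitions.
Variables (A : finType) (x : nat -> A) (a0 : A) (C0 c1 c2 n0 : nat).
Hypothesis urs : forall n, n0 <= n -> unique_right_special x n.
Hypothesis nep : not_eventually_periodic x.

Local Notation dec := (decomposition x a0 C0 c1 c2).
Local Notation cls := (block_class x a0).

Lemma decomposition_next l f L : dec l f L -> n0 <= L -> exists c,
  (cls f = ~~ c -> cls (next_cut x a0 l f) = c) /\
  dec (derived_len l c) (derived_start x a0 l f c) (L + l c).
Proof.
move=> d nL; have [|c dom] := dominant_class d nep; first by apply: urs; lia.
exists c; split; last exact: derived_decomposition.
by apply: dom; exact: cut_start.
Qed.

Lemma decomposition_large V l f L : dec l f L -> n0 <= L ->
  exists l' f' L', [/\ dec l' f' L', n0 <= L' & V <= l' true + l' false].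
Proof.
move=> d nL; elim: V => [|V [l' [f' [L' [d' nL' Vl]]]]]; first by exists l, f, L.
have [c [_ d'']] := decomposition_next d' nL'.
do 3 eexists; split; first exact: d''; first by lia.
by have := len_gt0 d' c; rewrite /derived_len; case: (c) => /=; lia.
Qed.

(* If the first two blocks are of the same kind [c], then deriving removes one of
   them and keeps the length [l c]; this stops because [x] is not [l c]-periodic
   from [f] on. *)
Lemma decomposition_distinct l f L : dec l f L -> n0 <= L ->
  exists l' f' L', [/\ dec l' f' L', n0 <= L', l true + l false <= l' true + l' false
    & cls (next_cut x a0 l' f') != cls f'].
Proof.
move=> d nL.
have [i [fi neq]] : exists i, f <= i /\ x (i + l (cls f)) <> x i.
  apply: contrapT => H; apply: (nep (N := f) (len_gt0 d (cls f))) => i fi.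
  by apply: contrapT => neq; apply: H; exists i.
have [m] := ubnP (i - f).
elim: m => // m IH in l f L d nL fi neq *; rewrite ltnS => im.
have [E|neqc] := eqVneq (cls (next_cut x a0 l f)) (cls f); last by exists l, f, L.
have [c [dom d']] := decomposition_next d nL.
have cf : cls f = c.
  by move: dom; rewrite E; case: (cls f); case: (c) => // /(_ erefl).
have lc0 := len_gt0 d c.
have sE : derived_start x a0 l f c = f + l c by rewrite /derived_start cf eqxx.
have cE : cls (f + l c) = c by move: E; rewrite /next_cut cf.
have far : f + l c <= i.
  rewrite leqNgt; apply/negP => lti; apply: neq.
  have := next_cut_same_periodic d (cut_start _ _ _ _) E (k := i - f).
  by rewrite cf (_ : f + (i - f) = i) ?subnKC //; apply; lia.
have [||||l' [f' [L' [d'' nL' le neq']]]] := IH _ _ _ d'.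
- by lia.
- by rewrite sE.
- by rewrite sE cE /derived_len eqxx -cf.
- by rewrite sE; lia.
exists l', f', L'; split => //; apply: leq_trans le.
by rewrite /derived_len; case: (c) => /=; lia.
Qed.

(** Up to constants, the first bound gives [g' <= 0.52 (u + v)] and the second [g >= 0.66 (u + v)].
    This forbids a merged block to be repeated at the start. *)
Lemma equal_blocks_absurd u v g g' :
  1662 * (u + v + (g' - C0)) <= 1000 * (g' + 2 * (u + v)) ->
  1662 * (u + v) <= 1000 * (g + u + v) + 2000 * c1 -> g <= g' ->
  20 * (C0 + c1) < u + v -> False.
Proof. lia. Qed.

Local Open Scope ring_scope.
Variables (R : archiRealFieldType) (b : R) (N : nat).
Hypothesis b1 : b <= 1.
Hypothesis late : forall n p q, (N <= n)%N -> (n <= p < q)%N -> same_end x p q n ->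
  (1 + b) * n%:R <= q%:R.

Section FirstBlocks.
Variables (l : bool -> nat) (f L : nat).
Hypothesis d : dec l f L.

(** Since [f <= L + C0], the prefixes ending at the first two cuts share [f - C0] letters. *)
Lemma late_first : b * f%:R <= (l (cls f))%:R + (2 * C0 + N)%:R.
Proof.
have [Nf|fN] := leqP N (f - C0).
  have := len_gt0 d (cls f) => l0; have := start_le d => sle.
  have := @late (f - C0) f (next_cut x a0 l f) Nf.
  rewrite /next_cut => /(_ ltac:(lia)) H.
  have {H} : (1 + b) * (f - C0)%:R <= (f + l (cls f))%:R.
    apply: H => k kf.
    apply: (contextE d); [exact: cut_start|exact: cut_next (cut_start _ _ _ _)|..];
      by rewrite /next_cut; lia.
  rewrite natrD; have [Cf|fC] := leqP C0 f.
    rewrite natrB // natrD natrM.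
    have : b * C0%:R <= C0%:R by rewrite ler_piMl.
    by have := ler0n R N; lra.
  have : b * f%:R <= f%:R by rewrite ler_piMl.
  have : f%:R <= C0%:R :> R by rewrite ler_nat ltnW.
  rewrite natrD natrM.
  by have := ler0n R N; have := ler0n R C0; have := ler0n R (l (cls f)); lra.
have : b * f%:R <= f%:R by rewrite ler_piMl.
have : f%:R <= (2 * C0 + N)%:R :> R by rewrite ler_nat; lia.
by have := ler0n R (l (cls f)); lra.
Qed.

(** The two cuts after [f] share [L] letters, and one block of each kind leads to the second of
    them. *)
Lemma late_distinct : (N <= L)%N -> cls (next_cut x a0 l f) != cls f ->
  (1 + b) * L%:R <= (f + l true + l false)%:R.
Proof.
move=> NL neq; set p := next_cut x a0 l f in neq.
have op : cut x a0 l f p := cut_next (cut_start _ _ _ _).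
have room := context_room d (cut_start _ _ _ _); rewrite -/p in room.
have -> : (f + l true + l false)%N = next_cut x a0 l p.
  rewrite /next_cut {1}/p /next_cut.
  by move: neq; case: (cls p); case: (cls f) => //=; lia.
have l0 := len_gt0 d (cls p).
apply: (late NL (p := p)); first by rewrite /next_cut; lia.
move=> k kL; apply: (contextE d) => //; first exact: cut_next.
  by lia.
by rewrite /next_cut; lia.
Qed.

Lemma late_equal : (N <= l (cls f))%N -> cls (next_cut x a0 l f) = cls f ->
  (1 + b) * (l (cls f) + (f - C0))%:R <= (f + 2 * l (cls f))%:R.
Proof.
set m := l (cls f) => Nm E.
have of0 : cut x a0 l f f := cut_start _ _ _ _.
have of1 := cut_next of0; rewrite /next_cut -/m in E of1.
have m0 : (0 < m)%N := len_gt0 d _.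
have -> : (f + 2 * m)%N = (f + m + m)%N by lia.
apply: (late (p := (f + m)%N)); [by lia|by lia|].
apply: same_endD => [k kf|k km].
  apply: (contextE d) => //; [by have := start_le d; lia|by lia|by lia].
exact: (blockE d of0 of1 (esym E)).
Qed.
End FirstBlocks.

Lemma late_scaled n m : 331 / 500 <= b -> (1 + b) * n%:R <= m%:R ->
  (1662 * n <= 1000 * m)%N.
Proof.
move=> hb h; rewrite -(ler_nat R) !natrM.
have : (331 / 500) * n%:R <= b * n%:R by rewrite ler_wpM2r.
lra.
Qed.

Lemma late_repetitions_absurd (r : R) l f L : 0 <= r -> r ^+ 2 = 10 ->
  r - 5 / 2 < b -> dec l f L -> (n0 <= L)%N -> False.
Proof.
move=> r0 r2 rb d0 nL0.
have hb : 331 / 500 <= b.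
  have : 3162 / 1000 <= r by nra.
  lra.
pose K := (C0 + c1 + c2 + N)%N.
(* [C] absorbs all additive errors, and lengths above [V] dominate [C]. *)
pose C := (2000 * K)%N; pose V := (1000 * C + 1000)%N.
have CC : (C0 + c2 <= C)%N by rewrite /C /K; lia.
have CN : (1000 * (2 * C0 + N) <= C)%N by rewrite /C /K; lia.
have Cc : (2000 * c1 <= C)%N by rewrite /C /K; lia.
have NcV : (N + c1 <= V)%N by rewrite /V /C /K; lia.
have NV : (N <= V)%N := leq_trans (leq_addr _ _) NcV.
have CV : (20 * (C0 + c1) < V)%N by rewrite /V /C /K; lia.
have VC : (1000 * C + 1000 <= V)%N by [].
clearbody V; clearbody C; clear K.
pose G u v f := exists l L, [/\ dec l f L, (n0 <= L)%N,
  cls (next_cut x a0 l f) != cls f, v = l (cls f) /\ u = l (~~ cls f) & (V <= u + v)%N].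
have sumE (h : bool -> nat) c : (h (~~ c) + h c = h true + h false)%N.
  by case: c => //=; rewrite addnC.
have [l1 [f1 [L1 [d1 nL1 V1]]]] := decomposition_large V d0 nL0.
have [l2 [f2 [L2 [d2 nL2 le2 neq2]]]] := decomposition_distinct d1 nL1.
have second u v g : G u v g -> (1662 * (u + v) <= 1000 * (g + u + v) + 2000 * c1)%N.
  case=> l' [L' [d' nL' neq [-> ->] Vuv]]; have := context_len d' => len.
  rewrite sumE in Vuv.
  have NL' : (N <= L')%N by move: (leq_trans NcV Vuv) len; clear; lia.
  have := late_scaled hb (late_distinct d' NL' neq).
  by move: (sumE l' (cls g)) len; clear; lia.
apply: (@renormalization_absurd G C V _ _ _ _ _ _ _ R r b
  (l2 (~~ cls f2)) (l2 (cls f2)) f2) => //.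
- by move=> u v g [l' [L' [d' _ _ [_ ->] _]]]; exact: len_gt0 d' _.
- by move=> u v g [l' [L' []]].
- move=> u v g [l' [L' [d' _ _ [-> ->] _]]]; rewrite sumE.
  by move: (start_le d') (context_len d') CC; clear; lia.
- move=> u v g [l' [L' [d' _ _ [-> _] _]]]; have := late_first d'.
  rewrite -(ler_nat R) natrD !natrM => h.
  have hg : (331 / 500) * g%:R <= b * g%:R by rewrite ler_wpM2r.
  have : (1000 * (2 * C0 + N))%:R <= C%:R :> R by rewrite ler_nat.
  by rewrite natrM; lra.
- by move=> u v g /second; move: Cc; clear; lia.
- move=> u v g guv; have sec := second _ _ _ guv.
  have [l' [L' [d' nL' neq [vE uE] Vuv]]] := guv.
  have [c [dom d'']] := decomposition_next d' nL'.
  set l'' := derived_len l' c in d''; set g' := derived_start x a0 l' g c in d''.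
  (* The merged block comes first: a leading block of class [c] has joined the prefix, and [neq]
     puts one of class [~~ c] after it. *)
  have [cg' [lg' [lg'' gE]]] : cls g' = ~~ c /\ (l'' (~~ c) = u + v)%N /\
      l'' c = l' c /\ (g <= g')%N.
    rewrite /l'' /g' /derived_len /derived_start eqxx.
    have -> : (~~ c == c) = false by case: (c).
    have -> : (l' c + l' (~~ c) = u + v)%N by rewrite addnC vE uE !sumE.
    case: eqP => [cg|/eqP cg]; split => //.
    + by move: neq; rewrite /next_cut cg; case: (cls _); case: (c).
    + by split => //; split => //; rewrite leq_addr.
    + by move: cg; case: (cls g); case: (c).
  have neq' : cls (next_cut x a0 l'' g') != cls g'.
    apply/eqP => E.
    have Nl : (N <= l'' (cls g'))%N by rewrite cg' lg'; apply: leq_trans Vuv.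
    have := late_scaled hb (late_equal d'' Nl E); rewrite cg' lg' => eqb.
    by apply: (equal_blocks_absurd eqb sec gE); apply: leq_trans Vuv.
  have Gnew : G (l' c) (u + v)%N g'.
    exists l'', (L' + l' c)%N; split => //; rewrite ?cg' ?negbK //.
    - by move: nL'; clear; lia.
    - by apply: leq_trans Vuv _; rewrite leq_addl.
  move: Gnew; rewrite /g' /derived_start; case: eqP => [<-|/eqP cg].
    by rewrite -vE; right.
  have -> : c = ~~ cls g by move: cg; case: (cls g); case: (c).
  by rewrite -uE; left.
- move=> u v g [l' [L' [d' _ _ [-> _] _]]]; have := late_first d'.
  have : (2 * C0 + N)%:R <= C%:R :> R by rewrite ler_nat; move: CN; clear; lia.
  lra.
- exists l2, L2; split => //; rewrite sumE; exact: leq_trans V1 le2.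
Qed.
End LateRepetitions.

(** * From the lower limit to late repetitions *)

Lemma rfun_le (A : finType) (x : nat -> A) n p q : n <= p < q -> same_end x p q n ->
  rfun x n <= q.
Proof.
move=> npq E; rewrite /rfun; case: ex_minnP => m _; apply; apply/asboolP.
split; first by lia.
exists (p - n + 1); split; first by lia.
move=> k kn; have := E (n - 1 - k) ltac:(lia).
have -> : p - 1 - (n - 1 - k) = (p - n + 1 + k).-1 by lia.
by have -> : q - 1 - (n - 1 - k) = (q - n + 1 + k).-1 by lia.
Qed.

(** The lower limit is the supremum of the tail infima; one of these exceeds [a], and it is finite,
    being at most [u N]. *)
Lemma lt_limn_einf (R : realType) (a : R) (u : nat -> R) :
  (a%:E < limn_einf (fun n => (u n)%:E))%E ->
  exists b N, (a < b)%R /\ forall n, N <= n -> (b <= u n)%R.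
Proof.
rewrite limn_einf_lim.
have -> : limn (einfs (fun n => (u n)%:E)) =
    ereal_sup (range (einfs (fun n => (u n)%:E))).
  by apply/cvg_lim => //; exact: cvg_einfs_sup.
move=> /ereal_sup_gt[_ [N _ <-]].
have le n : N <= n -> (einfs (fun n => (u n)%:E) N <= (u n)%:E)%E.
  by move=> Nn; apply: ereal_inf_lbound; exists n.
have := le N (leqnn N); move: le; case: (einfs _ N) => [b|//|//] le _.
by rewrite lte_fin => ab; exists b, N; split => // n /le; rewrite lee_fin.
Qed.

Theorem theorem3p7 (R : realType) (A : finType) (s : nat -> A) :
  quasi_sturmian s ->
  (rep R s <= (Num.sqrt 10 - 3 / 2)%:E)%E.
Proof.
move=> qs; rewrite leNgt; apply/negP => /lt_limn_einf[b [N [lt_b late]]].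
have [n0 urs] := quasi_sturmian_unique_right_special qs.
have nep := quasi_sturmian_not_eventually_periodic qs.
have [a0 [C0 [c1 [c2 [l [f [L [d nL]]]]]]]] := exists_decomposition (urs _ (leqnn n0)) nep.
have r0 : (0 <= Num.sqrt 10 :> R)%R := sqrtr_ge0 _.
have r2 : (Num.sqrt 10 ^+ 2 = 10 :> R)%R by rewrite sqr_sqrtr.
(* Hence [sqrt 10 - 5/2 < 1], and capping [b - 1] at 1 keeps it above [sqrt 10 - 5/2]. *)
have r72 : (Num.sqrt 10 < 7 / 2 :> R)%R by nra.
pose b' : R := (Num.min (b - 1) 1)%R.
apply: (@late_repetitions_absurd A s a0 C0 c1 c2 n0 urs nep R b' N.+1 _ _
  (Num.sqrt 10) l f L) => //.
- by rewrite ge_min lexx orbT.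
- move=> n p q Nn npq E; have n0' : (0 < n%:R :> R)%R by rewrite ltr0n; lia.
  have := late n ltac:(lia); rewrite ler_pdivlMr // => h.
  apply: (@le_trans _ _ (b * n%:R)%R).
    by rewrite ler_wpM2r ?(ltW n0') // addrC -lerBrDr ge_min lexx.
  by apply: le_trans h _; rewrite ler_nat; exact: rfun_le E.
- by rewrite lt_min; apply/andP; split; lra.
Qed.
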